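(* Let $G$ be the incidence graph of a Steiner triple system of order $v\ge 7$, let $b$ be the number of triples of the system, and let $n$ be the number of vertices of $G$. Then $b=\frac13\binom{v}{2}$, $n=b+v=\frac16(v^2+5v)$, and $$\operatorname{msr}(G)\ge b+3=\tfrac16(v^2-v+18).$$
   Context: A Steiner triple system of order $v$ consists of a set $X$ of $v$ points together with a collection of $3$-element subsets of $X$ (triples) such that every $2$-element subset of $X$ is contained in exactly one triple. Its incidence graph is the bipartite graph with one vertex for each point and one vertex for each triple, a point-vertex adjacent to a triple-vertex exactly when the triple contains the point. For an $n\times n$ Hermitian matrix $A$, the graph of $A$ is the simple graph on $v_1,\dots,v_n$ with $v_i\sim v_j$ ($i\neq j$) iff $A_{ij}\neq0$. $\operatorname{msr}(G)$, the minimum semidefinite rank of $G$, is the smallest rank among positive semidefinite Hermitian matrices whose graph is $G$; equivalently the smallest $d$ such that there is $r:V(G)\to\mathbb{C}^d$ with $\langle r(u),r(w)\rangle\neq0$ iff $\{u,w\}\in E(G)$ for all distinct $u,w$. *)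

(* Defs.v *)
From HB Require Import structures.
From mathcomp Require Import all_boot all_order all_algebra.
From mathcomp Require Import sesquilinear complex.
From mathcomp Require Import boolp reals.

Set Implicit Arguments.
Unset Strict Implicit.
Unset Printing Implicit Defensive.

Import Order.TTheory GRing.Theory Num.Theory.
Local Open Scope ring_scope.
Local Open Scope sesquilinear_scope.

Record sgraph := SGraph {
  svertex :> finType;
  sedge : rel svertex;
  sedge_sym : symmetric sedge;
  sedge_irrefl : irreflexive sedge }.

Definition steiner_triple_system (X : finType) (B : {set {set X}}) : Prop :=
  (forall t : {set X}, t \in B -> #|t| = 3%N) /\
  (forall p : {set X}, #|p| = 2%N ->
     exists! t : {set X}, t \in B /\ p \subset t).

Section IncidenceGraph.
Variables (X : finType) (B : {set {set X}}).

Definition incidence_vertex : finType := (X + {t : {set X} | t \in B})%type.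

Definition incidence_edge (u w : incidence_vertex) : bool :=
  match u, w with
  | inl x, inr t | inr t, inl x => x \in val t
  | _, _ => false
  end.

Lemma incidence_edge_sym : symmetric incidence_edge.
Proof. by case=> [x|t] [y|s]. Qed.

Lemma incidence_edge_irrefl : irreflexive incidence_edge.
Proof. by case. Qed.

Definition incidence_graph : sgraph :=
  SGraph incidence_edge_sym incidence_edge_irrefl.

End IncidenceGraph.

Section MinimumSemidefiniteRank.
Variable C : numClosedFieldType.

(* Since 0 <= z in C means that z is real and nonnegative, the second
   condition is the usual one on the quadratic form x^* A x. *)
Definition psdmx (n : nat) (A : 'M[C]_n) : Prop :=
  A \is hermsymmx /\ forall x : 'cV[C]_n, 0 <= (x ^t* *m A *m x) 0 0.

(* The vertices of G are listed as v_i = enum_val i; the diagonal of A is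
   unconstrained. *)
Definition has_graph (G : sgraph) (A : 'M[C]_#|G|) : Prop :=
  forall i j : 'I_#|G|, i != j ->
    (A i j != 0) = sedge (enum_val i : G) (enum_val j : G).

Definition msr_attained (G : sgraph) : pred nat := fun d =>
  `[< exists A : 'M[C]_#|G|, [/\ psdmx A, has_graph A & \rank A = d] >].

(* The signless Laplacian is positive semidefinite with graph G. *)
Lemma msr_attained_ex (G : sgraph) : exists d, msr_attained G d.
Proof.
pose D : 'M[C]_(#|{: G * G}|, #|G|) := \matrix_(k, i)
  (let p : G * G := enum_val k in
   ((sedge p.1 p.2) && ((enum_val i == p.1) || (enum_val i == p.2)))%:R).
have DE k i : (D k i)^* = D k i by rewrite mxE /= conjC_nat.
exists (\rank (D ^t* *m D)); apply/asboolP; exists (D ^t* *m D); split=> //.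
- split.
    apply/is_hermitianmxP; rewrite expr0 scale1r; apply/matrixP=> i j.
    rewrite !mxE rmorph_sum /=; apply: eq_bigr => k _.
    by rewrite rmorphM /= ![(D ^t* ) _ _]mxE ![D^T _ _]mxE /= conjCK DE mulrC.
  move=> x; have -> : x ^t* *m (D ^t* *m D) *m x = (D *m x) ^t* *m (D *m x).
    by rewrite trmx_mul map_mxM /= !mulmxA.
  rewrite mxE sumr_ge0 // => k _.
  by rewrite ![((D *m x) ^t* ) _ _]mxE ![(D *m x)^T _ _]mxE mulrC mul_conjC_ge0.
move=> i j ij.
have vij : (enum_val i : G) != enum_val j.
  by apply: contra ij => /eqP/enum_val_inj ->.
have E : (D ^t* *m D) i j = \sum_k D k i * D k j.
  by rewrite mxE; apply: eq_bigr => k _; rewrite [(D ^t* ) _ _]mxE [D^T _ _]mxE /= DE.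
have D0 k l : 0 <= D k l by rewrite mxE ler0n.
rewrite E; apply/idP/idP; last first.
  move=> e; rewrite psumr_neq0 /=; last by move=> k _; rewrite mulr_ge0.
  apply/hasP; exists (enum_rank ((enum_val i : G), (enum_val j : G))).
    by rewrite mem_index_enum.
  by rewrite !mxE enum_rankK /= e !eqxx orbT /= mulr1 ltr01.
rewrite psumr_neq0; last by move=> k _; rewrite mulr_ge0.
case/hasP=> k _; rewrite !mxE /= -natrM ltr0n.
case: (enum_val k) => a b /=.
case: (boolP (sedge a b)) => //= sab.
case: (eqVneq (enum_val i : G) a) => [ia|/= na].
  rewrite -ia (eq_sym (enum_val j)) (negbTE vij) /=.
  by case: eqP => [jb _|]; rewrite ?muln0 // ia jb.
case: (eqVneq (enum_val i : G) b) => //= ib.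
case: (eqVneq (enum_val j : G) a) => [ja _|/= nja].
  by rewrite sedge_sym ja ib.
by rewrite -ib (eq_sym (enum_val j)) (negbTE vij).
Qed.

Definition msr (G : sgraph) : nat := ex_minn (msr_attained_ex G).

End MinimumSemidefiniteRank.

(* Main.v *)
(** Let A be positive semidefinite with graph G and rank at most b + 2.
Eliminating the b pairwise orthogonal triple vertices by Schur complements
lowers the rank by b and leaves the Gram matrix of vectors [s x] in C^2, one per
point, such that <s x, s y><s y, s z><s z, s x> < 0 for every triple {x, y, z}.
For the Bloch vectors in R^3 this says that a triple spans a plane in which the
origin is interior to the triangle of the three vectors.  After projection along
a generic direction the sign of the planar determinant is therefore a tournament
on the points in which every triple is a cyclic triangle.  It is regular, and
the Pluecker relation makes out- and in-neighbourhoods transitive, so that the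
points and their antipodes alternate on a circle.  The arc between two
consecutive points is then opposite to a single point, which determines the
triple of the pair; this puts a point x and the last point it beats in two
different triples. *)

Require Import Defs.
From mathcomp Require Import all_boot all_order all_algebra.
From mathcomp Require Import complex reals.
From mathcomp Require Import boolp sesquilinear ring lra zify.

Set Implicit Arguments.
Unset Strict Implicit.
Unset Printing Implicit Defensive.

Import Order.TTheory GRing.Theory Num.Theory.
Local Open Scope ring_scope.

(** * Counting triples, and the third point of a pair *)

Section SteinerCounting.
Variables (X : finType) (B : {set {set X}}).
Hypothesis stsB : steiner_triple_system B.

Lemma sts_block_uniq (x y : X) (s t : {set X}) : x != y ->
  s \in B -> t \in B -> x \in s -> y \in s -> x \in t -> y \in t -> s = t.
Proof.
move=> xy sB tB xs ys xt yt.
have [|u [_ Eu]] := stsB.2 [set x; y]; first by rewrite cards2 xy.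
by rewrite -(Eu s) -1?(Eu t) //; split=> //; apply/subsetP=> z;
  rewrite !inE => /orP[] /eqP->.
Qed.

(** Double counting of incidences between triples and 2-subsets: a triple contains three of these,
    and each lies in a single triple. *)
Lemma card_sts : (#|B| * 3 = 'C(#|X|, 2))%N.
Proof.
have -> : 'C(#|X|, 2) = #|[set A : {set X} | #|A| == 2%N]|.
  rewrite -cardsT -cards_draws; apply: eq_card => A.
  by rewrite !inE subsetT.
rewrite -sum_nat_const -sum1_card.
have E (t : {set X}) : t \in B ->
    3%N = (\sum_(A : {set X} | (A \in [set A : {set X} | #|A| == 2%N]) &&
                               (A \subset t)) 1)%N.
  move=> tB; rewrite sum1_card; have -> : 3%N = 'C(#|t|, 2) by rewrite (stsB.1 t tB).
  by rewrite -cards_draws; apply: eq_card => A; rewrite [LHS]inE unfold_in inE andbC.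
rewrite (eq_bigr _ E).
rewrite (exchange_big_dep (mem [set A : {set X} | #|A| == 2%N])) /=; last first.
  by move=> t A _ /andP[].
apply: eq_bigr => A; rewrite inE => A2; have [t [[tB At] Et]] := stsB.2 A (eqP A2).
rewrite (big_pred1 t) // => s /=.
apply/andP/eqP => [[sB /andP[_ As]]|->]; first by rewrite (Et s).
by rewrite tB A2 At.
Qed.

Lemma sts_third : exists T : X -> X -> X,
  [/\ forall x y, x != y ->
        [/\ T x y != x, T x y != y & [set x; y; T x y] \in B],
      forall x y, x != y -> T y x = T x y
    & forall x y, x != y -> T x (T x y) = y].
Proof.
(* With [x != y] placed under the existential, a witness exists on the diagonal too, so choice
   applies to all pairs. *)
suff H x y : exists z, x != y -> [/\ z != x, z != y & [set x; y; z] \in B].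
  have [T HT] := choice (fun p => H p.1 p.2).
  pose U x y := T (x, y).
  have {}HT x y : x != y ->
      [/\ U x y != x, U x y != y & [set x; y; U x y] \in B] by apply: (HT (x, y)).
  exists U; split=> // x y xy; have [zx zy zB] := HT x y xy.
    have yx : y != x by rewrite eq_sym.
    have [uy ux uB] := HT y x yx.
    have := sts_block_uniq xy zB uB.
    rewrite !inE !eqxx !orbT /= => /(_ isT isT isT isT).
    by move/setP/(_ (U y x)); rewrite !inE eqxx orbT (negbTE ux) (negbTE uy) => /eqP.
  have xz : x != U x y by rewrite eq_sym.
  have [ux uz uB] := HT x (U x y) xz.
  have := sts_block_uniq xz zB uB.
  rewrite !inE !eqxx !orbT /= => /(_ isT isT isT isT).
  move/setP/(_ (U x (U x y))).
  by rewrite !inE eqxx orbT (negbTE ux) (negbTE uz) orbF => /eqP.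
have [->|xy] := eqVneq x y; first by exists y.
have [|t [[tB /subsetP pt] _]] := stsB.2 [set x; y]; first by rewrite cards2 xy.
have t3 := stsB.1 t tB.
have xt : x \in t by rewrite pt // !inE eqxx.
have yt : y \in t by rewrite pt // !inE eqxx orbT.
have : (0 < #|t :\ x :\ y|)%N.
  have := cardsD1 x t; have := cardsD1 y (t :\ x).
  by rewrite t3 xt !inE eq_sym xy yt; lia.
rewrite card_gt0 => /set0Pn[z]; rewrite !inE => /and3P[zy zx zt].
exists z => _; split=> //; suff <- : t = [set x; y; z] by [].
apply/esym/eqP; rewrite eqEcard t3; apply/andP; split.
  by apply/subsetP=> u; rewrite !inE => /orP[/orP[]|] /eqP->.
by rewrite -setUA cardsU1 !inE cards2 negb_or xy eq_sym zx eq_sym zy.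
Qed.

End SteinerCounting.

(** * Planar tournaments in which every triple is cyclic *)

Section CyclicTournament.
(* [T x y] stands for the third point of the triple through x and y, [d x y] for
   the determinant of planar vectors attached to x and y. *)
Variables (R : realDomainType) (X : finType) (T : X -> X -> X) (d : X -> X -> R).
Hypothesis TC : forall x y, x != y -> T y x = T x y.
Hypothesis TK : forall x y, x != y -> T x (T x y) = y.
Hypothesis dC : forall x y, d y x = - d x y.
Hypothesis d0 : forall x y, x != y -> d x y != 0.
Hypothesis d_plucker : forall a b x y,
  d a b * d x y - d a x * d b y + d a y * d b x = 0.
Hypothesis d_cyclic : forall x y, 0 < d x y -> 0 < d y (T x y).

Let beats x y := 0 < d x y.
Let O x := [set y | beats x y].
Let I x := [set y | beats y x].

Lemma beats_total x y : x != y -> beats x y || beats y x.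
Proof. by move=> /d0; rewrite /beats (dC x y) oppr_gt0 neq_lt orbC. Qed.

Lemma beats_asym x y : beats x y -> ~~ beats y x.
Proof. by rewrite /beats (dC x y) oppr_gt0 -leNgt => /ltW. Qed.

Lemma beats_neq x y : beats x y -> x != y.
Proof.
by apply: contraTneq => ->; apply/negP=> h; have := beats_asym h; rewrite h.
Qed.

Lemma beats_third x y : beats x y -> beats (T x y) x.
Proof.
move=> xy; have yz := d_cyclic xy.
have := d_cyclic yz; suff -> : T y (T x y) = x by [].
have yx : y != x by rewrite eq_sym beats_neq.
by rewrite (TC yx) TK.
Qed.

Lemma beats_third' x y : beats y x -> beats x (T x y).
Proof. by move=> yx; rewrite (TC (beats_neq yx)); apply: d_cyclic. Qed.

(** The Pluecker relation writes [d a c * d b x] as a sum of two positive products. *)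
Lemma beats_trans_in x : {in I x & &, transitive beats}.
Proof.
move=> b a c; rewrite !inE /beats => bx ax cx ab bc.
have := d_plucker a b c x; move/eqP.
rewrite addrAC subr_eq0 => /eqP E.
by have : 0 < d a c * d b x; [rewrite -E addr_gt0 ?mulr_gt0|rewrite pmulr_lgt0].
Qed.

Lemma beats_trans_out x : {in O x & &, transitive beats}.
Proof.
move=> b a c; rewrite !inE /beats => xb xa xc ab bc.
have := d_plucker x a b c; move/eqP.
rewrite addrAC subr_eq0 => /eqP E.
by have : 0 < d x b * d a c; [rewrite -E addr_gt0 ?mulr_gt0|rewrite pmulr_rgt0].
Qed.

(** An element with the most predecessors is last: one above it would have all of these and the
    element itself besides. The relation is a parameter so that its converse yields a first
    element. *)
Lemma last_element (A : {set X}) (r : rel X) a : a \in A ->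
  irreflexive r -> {in A & &, transitive r} ->
  {in A &, forall x y, x != y -> r x y || r y x} ->
  exists2 w, w \in A & {in A, forall x, x != w -> r x w}.
Proof.
move=> aA irr trA totA; pose below w := [set x in A | r x w].
have [w wA max_w] : exists2 w, w \in A &
    {in A, forall x, (#|below x| <= #|below w|)%N}.
  by case: (arg_maxnP (fun w => #|below w|) aA) => w wA max_w; exists w.
exists w => // x xA xw; have /orP[//|wx] := totA x w xA wA xw.
suff : (#|below w| < #|below x|)%N by rewrite ltnNge max_w.
apply: proper_card; apply/properP; split.
  apply/subsetP=> y; rewrite !inE => /andP[yA yw].
  by rewrite yA (trA w).
by exists w; rewrite !inE wA ?wx ?irr.
Qed.

Lemma beats_irr : irreflexive beats.
Proof. by move=> x; apply/negP=> /beats_neq; rewrite eqxx. Qed.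

(** The map [T x] is injective off [x] and exchanges [O x] with [I x]. *)
Lemma card_out x : #|O x| = #|I x|.
Proof.
have xO y : y \in O x -> x != y by rewrite inE => /beats_neq.
have xI y : y \in I x -> x != y by rewrite inE eq_sym => /beats_neq.
have injT : {in predC1 x &, injective (T x)}.
  by move=> y z; rewrite !inE => yx zx /(congr1 (T x)); rewrite !TK // eq_sym.
apply/eqP; rewrite eqn_leq; apply/andP; split.
  rewrite -(card_in_imset (f := T x) (D := O x)); last first.
    by move=> y z /xO yx /xO zx; apply: injT; rewrite inE eq_sym.
  apply/subset_leq_card/subsetP=> _ /imsetP[y + ->]; rewrite !inE.
  exact: beats_third.
rewrite -(card_in_imset (f := T x) (D := I x)); last first.
  by move=> y z /xI yx /xI zx; apply: injT; rewrite inE eq_sym.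
apply/subset_leq_card/subsetP=> _ /imsetP[y + ->]; rewrite !inE.
exact: beats_third'.
Qed.

Lemma card_outE x : #|X| = (#|O x|.*2).+1.
Proof.
rewrite -cardsT (cardsD1 x) inE; congr (_ + _)%N.
rewrite -addnn {2}card_out -cardsUI.
have -> : O x :&: I x = set0.
  by apply/setP=> y; rewrite !inE; apply/negP=> /andP[/beats_asym/negP].
rewrite cards0 addn0; apply: eq_card => y; rewrite !inE andbT.
apply/idP/orP => [yx|[] /beats_neq //]; last by rewrite eq_sym.
by apply/orP; rewrite beats_total // eq_sym.
Qed.

Lemma card_outC x y : #|O x| = #|O y|.
Proof. by have := card_outE x; have := card_outE y; lia. Qed.

(* Read on a circle: the points of [O x] and [I x] are the two open half
   circles at x, w is the end of the first and s the start of the second, so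
   x is the only point antipodal to the arc from w to s. *)
Lemma antipodal_third x w s :
  w \in O x -> {in O x, forall o, o != w -> beats o w} ->
  s \in I x -> {in I x, forall i, i != s -> beats s i} ->
  O w = I x /\ T w s = x.
Proof.
move=> wO lastw sI firsts.
(* A point beaten by [w] is neither [x] nor in [O x], so [O w] lies in [I x]; regularity makes the
   sizes equal. *)
have Ow : O w = I x.
  apply/eqP; rewrite eqEcard -card_out (card_outC w x) leqnn andbT.
  apply/subsetP=> y; rewrite !inE => wy.
  have yx : x != y.
    by apply: contraTneq wy => <-; apply: beats_asym; rewrite inE in wO.
  have /orP[xy|//] := beats_total yx.
  have := lastw y; rewrite inE xy eq_sym beats_neq // => /(_ isT isT).
  by move/beats_asym; rewrite wy.
split=> //; have ws : beats w s by have := sI; rewrite -Ow inE.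
have su : beats s (T w s) := d_cyclic ws.
have uw : beats (T w s) w := beats_third ws.
apply/eqP; apply: contraT => ux.
have uI : T w s \notin I x by rewrite -Ow inE; apply: beats_asym.
(* By the same count [s] beats exactly [x] and the rest of [I x]. Of these only [x] can be [T w s],
   which beats [w] and hence lies outside [O w = I x]. *)
have Os : O s = x |: (I x :\ s).
  apply/esym/eqP; rewrite eqEcard; apply/andP; split.
    apply/subsetP=> y; rewrite !inE => /orP[/eqP->|/andP[ys yx]].
      by rewrite inE in sI.
    by apply: firsts; rewrite // inE.
  have xI : x \notin I x :\ s by rewrite !inE beats_irr andbF.
  by rewrite cardsU1 xI (card_outC s x) card_out (cardsD1 s) sI.
have : T w s \in O s by rewrite inE.
rewrite Os !inE (negbTE ux) /= => /andP[_ ux'].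
by rewrite inE ux' in uI.
Qed.

Lemma cyclic_tournament_small : (#|X| <= 3)%N.
Proof.
rewrite leqNgt; apply/negP=> X4.
have /card_gt0P[x _] : (0 < #|X|)%N by lia.
have Ex := card_outE x.
have /card_gt0P[o oO] : (0 < #|O x|)%N by lia.
have /card_gt0P[i iI] : (0 < #|I x|)%N by rewrite -card_out; lia.
have tot (A : {set X}) : {in A &, forall y z, y != z -> beats y z || beats z y}.
  by move=> y z _ _; apply: beats_total.
have [w wO lastw] := last_element oO beats_irr (@beats_trans_out x) (tot _).
have [p pI lastp] := last_element iI beats_irr (@beats_trans_in x) (tot _).
have [s sI firsts] : exists2 s, s \in I x & {in I x, forall i, i != s -> beats s i}.
  apply: (last_element (r := fun y z => beats z y) iI beats_irr).
    by move=> b a c bI aI cI ba cb; apply: (beats_trans_in bI).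
  by move=> y z _ _; rewrite orbC; apply: beats_total.
have [Ow Tws] := antipodal_third wO lastw sI firsts.
have xw : beats x w by rewrite inE in wO.
(* Now [w] is the base point: [O w = I x] ends in [p], and [x] comes first in [I w]. *)
have [_ Tpx] : O p = I w /\ T p x = w.
  apply: antipodal_third; [by rewrite Ow|by rewrite Ow|by rewrite inE|].
  move=> y; rewrite inE => yw yx; have /orP[yx'|//] := beats_total yx.
  have : y \in O w by rewrite Ow inE.
  by rewrite inE => /beats_asym; rewrite yw.
have ws : beats w s by have := sI; rewrite -Ow inE.
have px : beats p x by rewrite inE in pI.
(* Both are the third point of the triple through [x] and [w]. So [I x] begins and ends with the
   same point, although it has at least two. *)
have sp : s = p.
  have Txw : T x w = p
    by rewrite -Tpx -(TC (beats_neq px)) TK // eq_sym beats_neq.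
  by rewrite -Txw -(TC (beats_neq xw)) -Tws TK ?beats_neq.
have /card_gt0P[j] : (0 < #|I x :\ p|)%N.
  by have := cardsD1 p (I x); rewrite pI -card_out; lia.
rewrite !inE => /andP[jp jx].
have : beats s j by apply: firsts; rewrite ?inE // sp.
by rewrite sp => /beats_asym/negP; apply; apply: lastp; rewrite ?inE.
Qed.

End CyclicTournament.

(** * Schur complements and Gram factorisation of positive semidefinite matrices *)

Section PositiveSemidefinite.
Variable C : numClosedFieldType.
Local Open Scope sesquilinear_scope.

Lemma adjmxM m n p (A : 'M[C]_(m, n)) (B : 'M_(n, p)) :
  (A *m B) ^t* = B ^t* *m A ^t*.
Proof. by rewrite trmx_mul map_mxM. Qed.

Lemma adjmxK m n (A : 'M[C]_(m, n)) : (A ^t* ) ^t* = A.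
Proof. by apply/matrixP=> i j; rewrite !mxE conjCK. Qed.

Lemma psdmx_herm n (S : 'M[C]_n) : psdmx S -> S ^t* = S.
Proof. by case=> /is_hermitianmxP E _; rewrite {2}E expr0 scale1r. Qed.

Lemma psdmx_conj n (S : 'M[C]_n) i j : psdmx S -> (S i j)^* = S j i.
Proof. by move=> /psdmx_herm E; rewrite -[in RHS]E !mxE. Qed.

Lemma psdmx_congr m n (S : 'M[C]_n) (L : 'M_(n, m)) :
  psdmx S -> psdmx (L ^t* *m S *m L).
Proof.
move=> psdS; have hS := psdmx_herm psdS; case: psdS => _ pS; split.
  apply/is_hermitianmxP; rewrite expr0 scale1r.
  by rewrite !adjmxM adjmxK hS mulmxA.
by move=> x; have := pS (L *m x); rewrite adjmxM !mulmxA.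
Qed.

Lemma psdmx_diag_ge0 n (S : 'M[C]_n) i : psdmx S -> 0 <= S i i.
Proof.
move=> [_ /(_ (delta_mx i 0))].
rewrite -mulmxA -colE mxE (bigD1 i) //= big1 => [|k ki].
  by rewrite !mxE !eqxx /= conjC1 mul1r addr0.
by rewrite !mxE (negbTE ki) /= conjC0 mul0r.
Qed.

(* With [S i i = 0] the form at [e_j + a e_i] is affine in [a], so it takes
   negative values unless [S i j = 0]. *)
Lemma psdmx_diag0 n (S : 'M[C]_n) i j : psdmx S -> S i i = 0 -> S i j = 0.
Proof.
move=> psdS Sii0; apply/eqP/negPn/negP => Sij0.
have ij : i != j by apply: contraNneq Sij0 => <-; rewrite Sii0.
have nrm : 0 < S i j * S j i by rewrite -(psdmx_conj i j psdS) mul_conjC_gt0.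
have Sjj := psdmx_diag_ge0 j psdS.
(* Chosen so that the form at [x] equals [- (S j j + 2)]. *)
pose c := (S j j + 1) / (S i j * S j i).
have c0 : c^* = c.
  by apply: CrealP; rewrite ger0_real // divr_ge0 ?(ltW nrm) // addr_ge0.
pose x : 'cV[C]_n := \col_k ((k == j)%:R - (k == i)%:R * (c * S i j)).
have Sx k : (S *m x) k 0 = S k j - S k i * (c * S i j).
  rewrite mxE (eq_bigr (fun l => S k l * (l == j)%:R -
      S k l * (l == i)%:R * (c * S i j))); last first.
    by move=> l _; rewrite mxE mulrBr !mulrA.
  rewrite sumrB -mulr_suml (bigD1 j) //= big1 => [|l lj]; last first.
    by rewrite (negbTE lj) mulr0.
  rewrite (bigD1 i) //= big1 => [|l li]; last by rewrite (negbTE li) mulr0.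
  by rewrite !eqxx !mulr1 !addr0.
have := psdS.2 x; rewrite -mulmxA mxE (bigD1 j) //= (bigD1 i) //= big1.
  rewrite !Sx !mxE !eqxx (negbTE ij) eq_sym (negbTE ij) /= Sii0 !mul0r !subr0.
  rewrite sub0r !mul1r conjC1 mul1r addr0 rmorphN rmorphM /= c0.
  rewrite (psdmx_conj i j psdS).
  have -> : S j j - S j i * (c * S i j) + - (c * S j i) * S i j =
            S j j - 2 * (c * (S i j * S j i)) by ring.
  rewrite divfK ?gt_eqF // (_ : _ - _ = - (S j j + 2)); last by ring.
  by apply/negP; rewrite lt_geF // oppr_lt0 ltr_wpDl.
move=> k /andP[kj ki]; rewrite !mxE (negbTE kj) (negbTE ki) mul0r subr0.
by rewrite rmorph0 mul0r.
Qed.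

Lemma psdmx_schur n (S : 'M[C]_n) i : psdmx S -> S i i != 0 ->
  let T := S - (S i i)^-1 *: (col i S *m row i S) in
  psdmx T /\ (\rank T < \rank S)%N.
Proof.
move=> psdS Sii T; have hS := psdmx_herm psdS.
have TE k l : T k l = S k l - S k i * S i l / S i i.
  by rewrite !mxE big_ord1 !mxE mulrC.
have Ti l : T i l = 0 by rewrite TE mulrAC divff // mul1r subrr.
have Tki k : T k i = 0 by rewrite TE -mulrA divff // mulr1 subrr.
(* Column elimination by [L] already clears row [i], so the adjoint row elimination [M] fixes the
   result: [T] is the congruence of [S] by [L]. *)
pose L : 'M[C]_n := 1%:M - (S i i)^-1 *: (delta_mx i 0 *m row i S).
have SL : S *m L = T.
  by rewrite mulmxBr mulmx1 -scalemxAr mulmxA -colE.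
pose M : 'M[C]_n := 1%:M - (S i i)^-1 *: (col i S *m delta_mx 0 i).
have LM : L ^t* = M.
  apply/matrixP=> k l; rewrite !mxE !big_ord1 !mxE rmorphB !rmorphM /= fmorphV /=.
  rewrite !conjC_nat !(psdmx_conj _ _ psdS) eq_sym andbT.
  by rewrite [(l == i)%:R * _]mulrC.
have LT : M *m T = T.
  rewrite mulmxBl mul1mx -scalemxAl -mulmxA -rowE -[RHS]subr0.
  suff -> : row i T = 0 by rewrite mulmx0 scaler0.
  by apply/rowP=> l; rewrite mxE Ti mxE.
split; first by rewrite -LT -SL -LM mulmxA; apply: psdmx_congr.
(* The row space of [T] is strictly smaller: column [i] vanishes on it, but not on that of [S]. *)
apply: rank_ltmx; rewrite ltmxE; apply/andP; split.
  have -> : T = M *m S.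
    by rewrite mulmxBl mul1mx -scalemxAl -mulmxA -rowE.
  exact: submxMl.
apply/negP=> /submxP[N EN]; case/negP: Sii; apply/eqP.
by rewrite EN mxE big1 // => k _; rewrite Tki mulr0.
Qed.

(** Cholesky factorisation: each Schur complement contributes its pivot row, divided by the root of
    the pivot, as a row of [W]. Once the diagonal vanishes, so does the matrix. *)
Lemma psdmx_gram n k (S : 'M[C]_n) : psdmx S -> (\rank S <= k)%N ->
  exists W : 'M[C]_(k, n), S = W ^t* *m W.
Proof.
elim: k S => [|k IHk] S psdS rS.
  exists 0; rewrite mulmx0; apply/eqP.
  by rewrite -mxrank_eq0 -leqn0.
have [[i Sii]|dg] := pselect (exists i, S i i != 0); last first.
  exists 0; rewrite mulmx0; apply/matrixP=> i j; rewrite mxE.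
  apply: psdmx_diag0 => //; apply/eqP/negPn/negP => Sii; apply: dg.
  by exists i.
have [psdT rT] := psdmx_schur psdS Sii.
have [|W EW] := IHk _ psdT; first by rewrite -ltnS (leq_trans rT).
pose s := sqrtC (S i i).
have s0 : 0 <= s by rewrite sqrtC_ge0 psdmx_diag_ge0.
have sJ : (s^-1)^* = s^-1 by apply: CrealP; rewrite ger0_real // invr_ge0.
exists (col_mx (s^-1 *: row i S) W : 'M[C]_(1 + k, n)).
set V : 'M[C]_(1 + k, n) := col_mx _ _; suff : S = V ^t* *m V by [].
rewrite /V tr_col_mx map_row_mx mul_row_col -EW.
rewrite -[LHS](addrNK ((S i i)^-1 *: (col i S *m row i S))).
rewrite addrC; congr (_ + _).
have Es : (S i i)^-1 = s^-1 * s^-1 by rewrite -invfM -expr2 sqrtCK.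
apply/matrixP=> j l; rewrite !(mxE, big_ord1) rmorphM /= sJ Es.
by rewrite (psdmx_conj _ _ psdS); ring.
Qed.

(* Columns with pairwise zero entries are not altered by each other's
   elimination, so the iterated Schur complement is a plain sum. *)
Lemma psdmx_schur_seq n (A : 'M[C]_n) (L : seq 'I_n) :
  psdmx A -> uniq L -> {in L, forall i, A i i != 0} ->
  {in L &, forall i j, i != j -> A i j = 0} ->
  let T := A - \sum_(i <- L) (A i i)^-1 *: (col i A *m row i A) in
  psdmx T /\ (\rank T + size L <= \rank A)%N.
Proof.
move=> psdA; elim: L => [|i L IHL] /=.
  by move=> _ _ _; rewrite big_nil subr0 addn0.
case/andP=> iL uL Ad A0.
have [||psdT rT] := IHL uL.
- by move=> j jL; apply: Ad; rewrite inE jL orbT.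
- by move=> j k jL kL; apply: A0; rewrite inE ?jL ?kL orbT.
move: psdT rT; set T := A - _ => psdT rT.
have Ei j : j \in L -> A j i = 0 /\ A i j = 0.
  move=> jL; have ji : j != i by apply: contraNneq iL => <-.
  by split; apply: A0; rewrite ?inE ?eqxx ?jL ?orbT // eq_sym.
have cT : col i T = col i A.
  apply/colP=> k; rewrite !mxE summxE big_seq big1 ?subr0 // => j /Ei[Eji _].
  by rewrite !mxE big_ord1 !mxE Eji mulr0 mulr0.
have rT' : row i T = row i A.
  apply/rowP=> k; rewrite !mxE summxE big_seq big1 ?subr0 // => j /Ei[_ Eij].
  by rewrite !mxE big_ord1 !mxE Eij mul0r mulr0.
have dT : T i i = A i i by have /colP/(_ i) := cT; rewrite !mxE.
have [|psdU rU] := psdmx_schur (i := i) psdT.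
  by rewrite dT Ad // inE eqxx.
rewrite big_cons opprD addrCA addrC -/T -cT -rT' -dT; split=> //.
by rewrite addnS (leq_trans _ rT) // -addSn leq_add2r.
Qed.

End PositiveSemidefinite.

(** * Bloch vectors of spinors and the geometry of triples in space *)

Section Bloch.
Variable R : rcfType.
Local Open Scope complex_scope.
Implicit Types a b c d w : R * R * R.

Definition dot a b := a.1.1 * b.1.1 + a.1.2 * b.1.2 + a.2 * b.2.

Definition cross a b : R * R * R :=
  (a.1.2 * b.2 - a.2 * b.1.2, a.2 * b.1.1 - a.1.1 * b.2,
   a.1.1 * b.1.2 - a.1.2 * b.1.1).

Definition triple w a b := dot w (cross a b).

Lemma tripleC w a b : triple w b a = - triple w a b.
Proof. by rewrite /triple /dot /=; ring. Qed.

Lemma triple_plucker w a b c d :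
  triple w a b * triple w c d - triple w a c * triple w b d
    + triple w a d * triple w b c = 0.
Proof. by rewrite /triple /dot /=; ring. Qed.

(** Both cross products are normal to one plane, hence parallel; this carries the sign of
    [triple w a b] over to [triple w b c]. *)
Lemma coplanar_triple w a b c : dot a (cross b c) = 0 ->
  dot (cross a b) (cross a b) * triple w b c =
  dot (cross a b) (cross b c) * triple w a b.
Proof.
move=> abc; apply/eqP; rewrite -subr_eq0.
rewrite (_ : _ - _ = dot a (cross b c) * triple b (cross a b) w).
  by rewrite abc mul0r.
rewrite /triple /dot /=; ring.
Qed.

(** On the moment curve [(1, t, t ^+ 2)] each condition excludes only the roots of a nonzero
    polynomial. *)
Lemma generic_vector (I : finType) (F : I -> R * R * R) :
  (forall i, F i != (0, 0, 0)) -> exists w, forall i, dot w (F i) != 0.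
Proof.
move=> F0; pose q i : {poly R} := Poly [:: (F i).1.1; (F i).1.2; (F i).2].
have qE i t : (q i).[t] = dot (1, t, t ^+ 2) (F i).
  by rewrite horner_Poly /= /dot /=; ring.
have q0 i : q i != 0.
  apply: contra (F0 i) => /eqP qi; apply/eqP.
  have E k : (Poly [:: (F i).1.1; (F i).1.2; (F i).2])`_k = 0.
    by rewrite -/(q i) qi coef0.
  have := (E 0%N, E 1%N, E 2%N); rewrite !coef_Poly /=.
  by case: (F i) => [[x y] z] /= [[-> ->] ->].
have p0 : \prod_i q i != 0 by rewrite prodf_seq_neq0; apply/allP=> i _; apply/implyP.
pose rs : seq R := [seq k%:R | k <- iota 0 (size (\prod_i q i))].
have urs : uniq rs.
  by rewrite map_inj_uniq ?iota_uniq // => k l /eqP; rewrite eqr_nat => /eqP.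
have : ~~ all (root (\prod_i q i)) rs.
  apply/negP=> ars; have := max_poly_roots p0 ars urs.
  by rewrite size_map size_iota ltnn.
case/allPn=> t _; rewrite rootE horner_prod prodf_seq_neq0 => /allP nz.
exists (1, t, t ^+ 2) => i; rewrite -qE.
by apply: (implyP (nz i _)); rewrite ?mem_index_enum.
Qed.

(* The vector of Pauli expectation values of a spinor. *)
Definition bloch (s : R[i] * R[i]) : R * R * R :=
  let: (p +i* q, r +i* t) := s in
  (2 * (p * r + q * t), 2 * (p * t - q * r),
   p ^+ 2 + q ^+ 2 - r ^+ 2 - t ^+ 2).

Definition hdot (s u : R[i] * R[i]) : R[i] := s.1^* * u.1 + s.2^* * u.2.

(** The product of the three [hdot] is the Bargmann invariant. Four times its imaginary part is the
    triple product of the Bloch vectors. Its real part, weighted by the squared norm of [y], enters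
    the second quantity with a negative sign. *)
Lemma bloch_block (x y z : R[i] * R[i]) :
  hdot x y * hdot y z * hdot z x < 0 ->
  dot (bloch x) (cross (bloch y) (bloch z)) = 0 /\
  0 < dot (cross (bloch x) (bloch y)) (cross (bloch y) (bloch z)).
Proof.
case: x y z => [[x1 x2] [x3 x4]] [[y1 y2] [y3 y4]] [[z1 z2] [z3 z4]].

rewrite /hdot /=; simpc.
pose a1 := x1 * y1 + x2 * y2 + (x3 * y3 + x4 * y4).
pose a2 := y1 * z1 + y2 * z2 + (y3 * z3 + y4 * z4).
pose a3 := z1 * x1 + z2 * x2 + (z3 * x3 + z4 * x4).
pose b1 := x1 * y2 - x2 * y1 + (x3 * y4 - x4 * y3).
pose b2 := y1 * z2 - y2 * z1 + (y3 * z4 - y4 * z3).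
pose b3 := z1 * x2 - z2 * x1 + (z3 * x4 - z4 * x3).
rewrite -/a1 -/a2 -/a3 -/b1 -/b2 -/b3.
set im := (X in 0 == X); set re := (X in X < 0) => /andP[/eqP im0 re0].
pose n := y1 ^+ 2 + y2 ^+ 2 + y3 ^+ 2 + y4 ^+ 2.
split.
  rewrite (_ : dot _ _ = 4 * im); first by rewrite -im0 mulr0.
  by rewrite /dot /cross /im /a1 /a2 /a3 /b1 /b2 /b3 /=; ring.
have n0 : 0 <= n by rewrite !addr_ge0 ?sqr_ge0.
(* These are squared moduli of [hdot x y] and [hdot y z]; if one vanished, so would the whole
   product. *)
have m12 : 0 < (a1 ^+ 2 + b1 ^+ 2) * (a2 ^+ 2 + b2 ^+ 2).
  rewrite lt0r mulr_ge0 ?addr_ge0 ?sqr_ge0 // andbT.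
  apply: contraTneq re0 => m0; rewrite -leNgt.
  suff : re ^+ 2 <= 0 by rewrite real_exprn_even_le0 ?num_real //= => /eqP->.
  have -> : re ^+ 2 = (a1 ^+ 2 + b1 ^+ 2) * (a2 ^+ 2 + b2 ^+ 2) *
      (a3 ^+ 2 + b3 ^+ 2) - im ^+ 2 by rewrite /re /im; ring.
  by rewrite m0 mul0r -im0 expr0n subr0.
rewrite (_ : dot _ _ =
  4 * ((a1 ^+ 2 + b1 ^+ 2) * (a2 ^+ 2 + b2 ^+ 2) - n * re)).
  by rewrite mulr_gt0 // subr_gt0 (le_lt_trans _ m12) // mulr_ge0_le0 // ltW.
by rewrite /dot /cross /n /re /a1 /a2 /a3 /b1 /b2 /b3 /=; ring.
Qed.

End Bloch.

(** * Spinors attached to the points of a Steiner triple system *)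

Lemma gram_hdot (R : rcfType) n (W : 'M[R[i]]_(2, n)) i j :
  (W ^t* *m W)%sesqui i j = hdot (W 0 i, W 1 i) (W 0 j, W 1 j).
Proof.
rewrite mxE big_ord_recl big_ord1 !mxE.
by have -> : lift ord0 ord0 = 1 :> 'I_2 by apply: val_inj.
Qed.

Lemma sts_spinors_small (R : rcfType) (X : finType) (B : {set {set X}})
    (s : X -> R[i] * R[i]) :
  steiner_triple_system B ->
  (forall x y z, x != y -> y != z -> x != z -> [set x; y; z] \in B ->
     hdot (s x) (s y) * hdot (s y) (s z) * hdot (s z) (s x) < 0) ->
  (#|X| <= 3)%N.
Proof.
move=> stsB neg; have [T [TB TC TK]] := sts_third stsB.
pose n x := bloch (s x).
have block x y : x != y ->
    dot (n x) (cross (n y) (n (T x y))) = 0 /\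
    0 < dot (cross (n x) (n y)) (cross (n y) (n (T x y))).
  move=> xy; have [zx zy zB] := TB x y xy.
  by apply/bloch_block/neg => //; rewrite eq_sym.
(* The value on the diagonal is an arbitrary nonzero vector, since there the cross product
   vanishes. *)
pose F (p : X * X) :=
  if p.1 == p.2 then (1, 0, 0) else cross (n p.1) (n p.2).
have [p|w w0] := @generic_vector R _ F.
  rewrite /F; case: (eqVneq p.1 p.2) => [_|xy].
    by rewrite !xpair_eqE oner_eq0.
  by have [_] := block _ _ xy; apply: contraTneq => ->;
    rewrite /dot /= !mul0r !addr0 ltxx.
pose d x y := triple w (n x) (n y).
apply: (@cyclic_tournament_small R X T d) => //.
- by move=> x y; apply: tripleC.
- by move=> x y xy; have := w0 (x, y); rewrite /F /= (negbTE xy).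
- by move=> a b x y; apply: triple_plucker.
move=> x y dxy; have xy : x != y.
  apply: contraTneq dxy => ->; have := tripleC w (n y) (n y).
  by rewrite /d => E; rewrite -leNgt; lra.
have [cop pos] := block x y xy.
have dot_ge0 : 0 <= dot (cross (n x) (n y)) (cross (n x) (n y)).
  by rewrite /dot !addr_ge0 // -expr2 sqr_ge0.
have : 0 < dot (cross (n x) (n y)) (cross (n x) (n y)) * d y (T x y).
  by rewrite (coplanar_triple w cop) mulr_gt0.
by case: (ltrP 0 (d y (T x y))) => // le0; rewrite ltNge mulr_ge0_le0.
Qed.

(** * Eliminating the triple vertices, and the rank bound *)

Lemma msr_incidence (R : rcfType) (X : finType) (B : {set {set X}}) :
  steiner_triple_system B -> (3 < #|X|)%N ->
  (#|B| + 3 <= msr R[i] (incidence_graph B))%N.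
Proof.
move=> stsB X4; rewrite /msr; case: ex_minnP => m /asboolP[A [psdA gA rA]] _.
rewrite leqNgt; apply: contraL X4 => m_lt; rewrite -leqNgt.
pose G := incidence_graph B.
pose P (x : X) : 'I_#|G| := enum_rank (inl x : G).
pose Q (t : {t | t \in B}) : 'I_#|G| := enum_rank (inr t : G).
have edge (u w : G) : u != w ->
    (A (enum_rank u) (enum_rank w) != 0) = sedge u w.
  move=> uw; rewrite gA ?enum_rankK //.
  by apply: contra uw => /eqP/enum_rank_inj->.
have PQ x t : (A (P x) (Q t) != 0) = (x \in val t) by rewrite edge.
have Qinj : injective Q by move=> t u /enum_rank_inj[].
(* A zero pivot would force a zero row, but a triple vertex has neighbours. *)
have QQ t : A (Q t) (Q t) != 0.
  have /card_gt0P[x xt] : (0 < #|val t|)%N by rewrite (stsB.1 _ (valP t)).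
  apply: contraL xt => /eqP Q0; rewrite -PQ negbK -(psdmx_conj _ _ psdA).
  by rewrite (psdmx_diag0 _ psdA Q0) conjC0.
have Qpos t : 0 < A (Q t) (Q t) by rewrite lt0r QQ psdmx_diag_ge0.
pose L := [seq Q t | t <- enum {: {t | t \in B}}].
have [|i|i j|psdT rT] := psdmx_schur_seq (L := L) psdA.
- by rewrite map_inj_uniq ?enum_uniq.
- by case/mapP=> t _ ->.
- case/mapP=> t _ -> /mapP[u _ ->] tu; apply/eqP/negPn.
  by rewrite edge //; apply: contra tu => /eqP E; rewrite /Q E.
move: psdT rT; set T := A - _ => psdT rT.
have [|W TW] := @psdmx_gram _ _ 2%N T psdT.
  have sB : #|{: {t | t \in B}}| = #|B| by rewrite card_sig; apply: eq_card.
  move: rT; rewrite size_map -cardE sB rA => rT.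
  by rewrite -ltnS -(ltn_add2r #|B|) (leq_ltn_trans rT) // addnC.
pose s x := (W 0 (P x), W 1 (P x)).
have hs x y : hdot (s x) (s y) = T (P x) (P y).
  by rewrite TW gram_hdot.
have TE x y (t : {t | t \in B}) : x != y -> x \in val t -> y \in val t ->
    T (P x) (P y) = - ((A (Q t) (Q t))^-1 * (A (P x) (Q t) * A (Q t) (P y))).
  move=> xy xt yt.
  (* Distinct points are not adjacent, and only the triple through both contributes to the sum. *)
  have Axy : A (P x) (P y) = 0.
    by apply/eqP/negPn; rewrite edge.
  rewrite !mxE Axy sub0r summxE big_map big_enum (bigD1 t) //= big1 => [|u ut].
    by rewrite !mxE big_ord1 !mxE addr0.
  rewrite !mxE big_ord1 !mxE.
  have [xu|] := boolP (x \in val u); last first.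
    by rewrite -PQ negbK => /eqP->; rewrite mul0r mulr0.
  have [yu|] := boolP (y \in val u).
    by case/eqP: ut; apply/val_inj/(sts_block_uniq stsB xy (valP u) (valP t)).
  rewrite -PQ negbK => /eqP y0.
  by rewrite -(psdmx_conj (P y) (Q u) psdA) y0 conjC0 !mulr0.
apply: (sts_spinors_small (s := s) stsB) => x y z xy yz xz tB.
pose t : {t | t \in B} := exist (fun u : {set X} => u \in B) _ tB.
have [xt yt zt] : [/\ x \in val t, y \in val t & z \in val t].
  by rewrite /t /= !inE !eqxx !orbT.
have zx : z != x by rewrite eq_sym.
rewrite !hs (TE x y t) // (TE y z t) // (TE z x t) //.
have Apos u : u \in val t -> 0 < A (P u) (Q t) * A (Q t) (P u).
  by move=> ut; rewrite -(psdmx_conj (P u) (Q t) psdA) mul_conjC_gt0 PQ.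
(* Round the triple each entry of [A] meets its conjugate, leaving squared moduli and three minus
   signs. *)
set a := A (Q t) (Q t); rewrite (_ : _ * _ = - (a^-1 ^+ 3 *
  ((A (P x) (Q t) * A (Q t) (P x)) * (A (P y) (Q t) * A (Q t) (P y)) *
   (A (P z) (Q t) * A (Q t) (P z))))); last by ring.
rewrite oppr_lt0 mulr_gt0 ?exprn_gt0 ?invr_gt0 ?Qpos //.
exact: mulr_gt0 (mulr_gt0 (Apos x xt) (Apos y yt)) (Apos z zt).
Qed.

Theorem theorem4p4 (R : realType) (X : finType) (B : {set {set X}})
    (v b n : nat) (G : sgraph) :
  steiner_triple_system B ->
  v = #|X| -> (7 <= v)%N ->
  G = incidence_graph B -> b = #|B| -> n = #|G| ->
  [/\ b%:R = 1 / 3 * 'C(v, 2)%:R :> rat,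
      n = (b + v)%N,
      n%:R = 1 / 6 * (v%:R ^+ 2 + 5 * v%:R) :> rat,
      (b + 3 <= msr R[i] G)%N
    & (b + 3)%:R = 1 / 6 * (v%:R ^+ 2 - v%:R + 18) :> rat].
Proof.
move=> stsB vE v7 -> bE ->.
have nE : #|incidence_graph B| = (b + v)%N.
  by rewrite /= card_sum card_sig -vE -bE addnC.
have b3 : b%:R * 3 = 'C(v, 2)%:R :> rat.
  by rewrite -natrM bE vE card_sts.
have v2 : 'C(v, 2)%:R * 2 = v%:R ^+ 2 - v%:R :> rat.
  (* Stated additively to avoid truncated subtraction. *)
  have : ('C(v, 2) * 2 + v = v ^ 2)%N.
    by have := mul_bin_diag v 1; rewrite bin1; nia.
  by move/(congr1 (fun k => k%:R : rat)); rewrite natrD natrM natrX => <-; ring.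
rewrite nE; split=> //.
- by lra.
- by rewrite natrD; lra.
- by rewrite bE msr_incidence // -vE (leq_trans _ v7).
- by rewrite natrD; lra.
Qed.
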